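(* Suppose that for every non-archimedean local field $\mathbb F$ of characteristic $0$ and every finite-dimensional $\mathbb F$-vector space $V$, every $GL(V)$-invariant distribution on $\mathfrak g\times V\times V^*$, where $\mathfrak g=\mathrm{End}_{\mathbb F}(V)$ is the Lie algebra of $GL(V)$, is invariant under $\sigma$. Then for every non-archimedean local field $\mathbb F$ of characteristic $0$ and every finite-dimensional $\mathbb F$-vector space $V$, every $GL(V)$-invariant distribution on $GL(V)\times V\times V^*$ is invariant under $\sigma$.
   Context: For a totally disconnected, locally compact Hausdorff space $X$ countable at infinity, $\mathcal S(X)$ is the space of locally constant compactly supported functions $X\to\mathbb C$ and distributions are linear forms on $\mathcal S(X)$; $T$ is invariant under a homeomorphism $\phi$ if $\langle T,f\circ\phi\rangle=\langle T,f\rangle$ for all $f$. The group $GL(V)$ acts on $\mathfrak g\times V\times V^*$ and on $GL(V)\times V\times V^*$ by $g(x,v,v^* )=(gxg^{-1},gv,{}^tg^{-1}v^* )$. Choose a basis $(e_i)$ of $V$ with dual basis $(e_i^* )$, let $u:V\to V^*$ be the linear map with $u(e_i)=e_i^*$; on both spaces $\sigma(x,v,v^* )=(u^{-1}\,{}^tx\,u,\;u^{-1}(v^* ),\;u(v))$. The action of $\sigma$ on invariant distributions is independent of the basis. *)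

(* Defs.v *)
From HB Require Import structures.
From mathcomp Require Import all_boot all_order all_algebra.
From mathcomp Require Import all_classical all_reals topology.
From mathcomp Require Import complex.
Set Implicit Arguments.
Unset Strict Implicit.
Unset Printing Implicit Defensive.
Import Order.TTheory GRing.Theory Num.Theory.
Local Open Scope classical_set_scope.
Local Open Scope ring_scope.

(* A field with a nontrivial ultrametric absolute value that is locally
   compact for the topology defined by the absolute value. *)
HB.mixin Record isNonArchLocalField (R : realType) F
    of Topological F & GRing.Field F := {
  absv : F -> R;
  absv_ge0 : forall x, 0 <= absv x;
  absv_eq0 : forall x, (absv x == 0) = (x == 0);
  absvM : forall x y, absv (x * y) = absv x * absv y;
  absv_ultra : forall x y, absv (x + y) <= Num.max (absv x) (absv y);
  absv_nontrivial : exists x, x != 0 /\ absv x != 1;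
  absv_nbhs : forall x : F,
    nbhs x = filter_from [set e : R | 0 < e]
                         (fun e => [set y | absv (x - y) < e]);
  absv_locally_compact : locally_compact [set: F]
}.

#[short(type="nonarchLocalFieldType")]
HB.structure Definition NonArchLocalField (R : realType) :=
  { F of Topological F & GRing.Field F & isNonArchLocalField R F }.

Section SchwartzSpace.
Variables (R : realType) (X : topologicalType).

Definition locally_constant (T : Type) (f : X -> T) :=
  forall x, \forall y \near x, f y = f x.

Definition compactly_supported (f : X -> R[i]) :=
  compact (closure [set x | f x != 0]).

Definition schwartz_pred : {pred X -> R[i]} :=
  fun f => `[< locally_constant f /\ compactly_supported f >].

Record schwartz := Schwartz {
  schwartz_fun :> X -> R[i];
  schwartzP : schwartz_fun \in schwartz_pred
}.

HB.instance Definition _ := [isSub for schwartz_fun].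
HB.instance Definition _ := [Choice of schwartz by <:].

Lemma schwartz_submod_closed : submod_closed schwartz_pred.
Proof.
split=> [|a f g].
  apply/asboolP; split=> [x|]; first exact: nearW.
  rewrite /compactly_supported (_ : [set _ | _] = set0) ?closure0.
    exact: compact0.
  by apply/seteqP; split=> x //=; rewrite eqxx.
move=> /asboolP[lf cf] /asboolP[lg cg]; apply/asboolP; split=> [x|].
  by near=> y; congr (_ * _ + _); near: y; [exact: lf|exact: lg].
apply: (subclosed_compact _ (compactU cf cg)); first exact: closed_closure.
rewrite -closureU; apply: closureS => x /=.
have [fx|fx] := eqVneq (f x) 0; last by left.
have [gx|gx] := eqVneq (g x) 0; last by right.
by rewrite (_ : (a *: f + g) x = a * f x + g x)// fx gx mulr0 addr0 eqxx.
Unshelve. all: by end_near. Qed.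

HB.instance Definition _ :=
  GRing.isSubmodClosed.Build R[i] (X -> R[i]) schwartz_pred
    schwartz_submod_closed.
HB.instance Definition _ := [SubChoice_isSubLmodule of schwartz by <:].

Definition distribution := {scalar schwartz}.

(* For a homeomorphism phi, f \o phi is again in the Schwartz space; h is that
   element. *)
Definition invariant_under (phi : X -> X) (T : distribution) :=
  forall f h : schwartz, h = f \o phi :> (X -> R[i]) -> T h = T f.

End SchwartzSpace.

Section Spaces.
Variables (R : realType) (F : nonarchLocalFieldType R).

Definition fdtop (V : vectType F) : Type := V.

HB.instance Definition _ (V : vectType F) := Vector.on (fdtop V).

(* The topology transported from F^n by the coordinates in a basis; it does
   not depend on the basis. *)
HB.instance Definition _ (V : vectType F) :=
  Topological.copy (fdtop V)
    (initial_topology (fun v : V => \row_i coord (vbasis {:V}) i v)).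

Variable V : vectType F.

Definition dual : vectType F := 'Hom(V, F^o).

(* By finite dimension, lker x == 0 means that x is invertible. *)
Definition GL : set (fdtop 'End(V)) := [set x | lker x == 0%VS].

Definition lieSpace : topologicalType :=
  (fdtop 'End(V) * fdtop V * fdtop dual)%type.

Definition groupSpace : topologicalType := (GL * fdtop V * fdtop dual)%type.

Definition conj_end (g x : 'End(V)) : 'End(V) := (g \o x \o g^-1)%VF.

Definition act_lie (g : GL) (p : lieSpace) : lieSpace :=
  let: (x, v, w) := p in
  (conj_end (\val g) x, (\val g : 'End(V)) v, (w \o (\val g)^-1)%VF).

Lemma GL_conj (g x : GL) : conj_end (\val g) (\val x) \in GL.
Proof.
case: g x => [g /set_mem/lker0P gI] [x /set_mem/lker0P xI] /=.
apply/mem_set/lker0P => u v; rewrite !comp_lfunE => /gI/xI.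
have gV := lker0_lfunVK (introT lker0P gI).
exact: (can_inj gV).
Qed.

Definition act_group (g : GL) (p : groupSpace) : groupSpace :=
  let: (x, v, w) := p in
  (SigSub (GL_conj g x) : GL, (\val g : 'End(V)) v, (w \o (\val g)^-1)%VF).

Definition tr_fun (x : 'End(V)) (w : dual) : dual := (w \o x)%VF.

Lemma tr_fun_linear x : linear (tr_fun x).
Proof. by move=> a w w'; rewrite /tr_fun comp_lfunDl comp_lfunZl. Qed.

HB.instance Definition _ x := GRing.isSemilinear.Build F dual dual _ (tr_fun x)
  (GRing.semilinear_linear (tr_fun_linear x)).

Definition tr (x : 'End(V)) : 'End(dual) := linfun (tr_fun x).

Section Sigma.
Variable e : (\dim {:V}).-tuple V.

Definition dual_vect (i : 'I_(\dim {:V})) : dual :=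
  linfun (coord e i : V -> F^o).

Definition u_fun (v : V) : dual := \sum_i coord e i v *: dual_vect i.

Lemma u_fun_linear : linear u_fun.
Proof.
move=> a v w; rewrite /u_fun scaler_sumr -big_split; apply: eq_bigr => i _ /=.
by rewrite linearP scalerDl scalerA.
Qed.

HB.instance Definition _ := GRing.isSemilinear.Build F V dual _ u_fun
  (GRing.semilinear_linear u_fun_linear).

(* The linear map with e_i |-> e_i^* when e is a basis. *)
Definition u_map : 'Hom(V, dual) := linfun u_fun.

Definition sigma_end (x : 'End(V)) : 'End(V) :=
  (u_map^-1 \o tr x \o u_map)%VF.

Definition sigma_lie (p : lieSpace) : lieSpace :=
  let: (x, v, w) := p in (sigma_end x, u_map^-1%VF w, u_map v).

Hypothesis e_basis : basis_of {:V} e.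

Lemma u_map_basis (i : 'I_(\dim {:V})) : u_map e`_i = dual_vect i.
Proof.
rewrite lfunE /= /u_fun (bigD1 i)//= coord_free ?(basis_free e_basis)//.
rewrite eqxx scale1r big1 ?addr0// => j ji.
rewrite coord_free ?(basis_free e_basis)//.
by rewrite eq_sym (negbTE ji) scale0r.
Qed.

Lemma u_mapK : cancel u_map u_map^-1%VF.
Proof.
apply: lker0_lfunK; apply/lker0P => v w.
rewrite !lfunE /= => /lfunP uvw.
rewrite (coord_basis e_basis (memvf v)) (coord_basis e_basis (memvf w)).
apply: eq_bigr => j _; congr (_ *: _).
move: (uvw e`_j); rewrite /u_fun !sum_lfunE.
have uE a : \sum_i (coord e i a *: dual_vect i) e`_j = coord e j a.
  rewrite (bigD1 j)//= !lfunE/= lfunE/= coord_free ?(basis_free e_basis)// eqxx.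
  rewrite big1 ?addr0 => [|i ij]; first exact: mulr1.
  rewrite !lfunE/= lfunE/= coord_free ?(basis_free e_basis)//.
  by rewrite eq_sym (negbTE ij); exact: mulr0.
by rewrite !uE.
Qed.

Lemma u_mapVK : cancel u_map^-1%VF u_map.
Proof.
move=> w; apply: limg_lfunVK.
rewrite (_ : w = u_map (\sum_(i < \dim {:V}) (w e`_i : F) *: e`_i)) ?memv_img ?memvf//.
rewrite linear_sum; apply/lfunP => v /=.
rewrite {1}(coord_basis e_basis (memvf v)) linear_sum sum_lfunE.
apply: eq_bigr => i _; rewrite !linearZ/= u_map_basis !lfunE/= lfunE/=.
exact: mulrC.
Qed.

Lemma GL_sigma (x : GL) : sigma_end (\val x) \in GL.
Proof.
case: x => [x /set_mem xI] /=; apply/mem_set/lker0P => v w.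
rewrite !comp_lfunE => /(can_inj u_mapVK).
rewrite ![tr _ _]lfunE/= => /(congr1 (fun f : dual => (f \o x^-1)%VF)).
by rewrite /tr_fun !lker0_compfK// => /(can_inj u_mapK).
Qed.

Definition sigma_group (p : groupSpace) : groupSpace :=
  let: (x, v, w) := p in
  (SigSub (GL_sigma x) : GL, u_map^-1%VF w, u_map v).

End Sigma.
End Spaces.

Arguments GL {R F} V.

(* Main.v *)
Require Import Defs.
From HB Require Import structures.
From mathcomp Require Import all_boot all_order all_algebra.
From mathcomp Require Import all_classical all_reals topology.
From mathcomp Require Import complex.
Set Implicit Arguments.
Unset Strict Implicit.
Unset Printing Implicit Defensive.
Import Order.TTheory GRing.Theory Num.Theory.
Local Open Scope classical_set_scope.
Local Open Scope ring_scope.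

(* The function |det x| is locally constant away from 0 on End(V), invariant
   under conjugation and under sigma.  Hence for eps > 0 the set
   A = {(x, v, w) : |det x| >= eps} is clopen in End(V) x V x V^*, stable under
   GL(V) and sigma, and contained in GL(V) x V x V^*.  Given an invariant
   distribution T on the group space, f |-> T (1_A f) is therefore an invariant
   distribution on the Lie algebra space, to which the hypothesis applies.  By
   compactness of its support, every test function on the group space is
   supported in A for some eps, and there the two distributions agree. *)

(** * Transfer of test functions along an embedding *)

Section Embedding.
Variables (R : realType) (X Y : topologicalType) (j : Y -> X).
Hypothesis j_inj : injective j.
Hypothesis j_cont : continuous j.
(** With injectivity this is continuity of the inverse of [j] on its image, phrased through
    neighbourhoods in [X] so that no inverse map is needed. *)
Hypothesis j_emb : forall (y : Y) (U : set Y), nbhs y U ->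
  \forall x \near j y, forall y', j y' = x -> U y'.

(** A filter on the preimage is pushed forward by [j]; its cluster point in [C] has the form [j y],
    and [j_emb] makes [y] a cluster point of the original filter. *)
Lemma compact_preimage_embedding (C : set X) :
  compact C -> C `<=` range j -> compact (j @^-1` C).
Proof.
move=> cC Cj G GF GC.
have [|x [Cx clx]] := cC (j @ G) _; first exact: GC.
have [y _ yx] := Cj _ Cx; subst x; exists y; split => // B U GB /j_emb yU.
have jB : G (j @^-1` (j @` B)).
  by apply: (filterS _ GB) => y' By'; exists y'.
by have [_ [[y' By' <-] /(_ _ erefl) Uy']] := clx _ _ jB yU; exists y'.
Qed.

Variable a : X -> bool.
Hypothesis a_lc : locally_constant a.
Hypothesis a_range : forall x, a x -> range j x.

Lemma closed_locally_constant : closed [set x | a x].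
Proof.
move=> x clx /=; have [x' [/= ax' ax]] := clx _ (a_lc x).
by rewrite -ax.
Qed.

Definition cutoff_fun (f : X -> R[i]) (y : Y) : R[i] :=
  if a (j y) then f (j y) else 0.

(** The support of [f] may leave the image of [j], so its preimage alone need not be compact; its
    part where [a] holds is compact and lies in that image. *)
Lemma schwartz_cutoff (f : schwartz R X) : cutoff_fun f \in @schwartz_pred R Y.
Proof.
have /asboolP[f_lc f_c] := schwartzP f.
apply/asboolP; split=> [y|].
  have ay : \forall y' \near y, a (j y') = a (j y) := j_cont (a_lc (j y)).
  have fy : \forall y' \near y, f (j y') = f (j y) := j_cont (f_lc (j y)).
  by apply: filterS2 ay fy => y' ay fy; rewrite /cutoff_fun ay fy.
pose C := closure [set x | f x != 0] `&` [set x | a x].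
have cC : compact C.
  by apply: compact_closedI => //; exact: closed_locally_constant.
have C_j : compact (j @^-1` C).
  by apply: compact_preimage_embedding => // x [_ /a_range].
apply: (subclosed_compact _ C_j); first exact: closed_closure.
have Ccl : closed (j @^-1` C).
  apply: preimage_closed => //.
  by apply: closedI; [exact: closed_closure|exact: closed_locally_constant].
rewrite closureE; apply: smallest_sub => // y /=; rewrite /cutoff_fun.
case: ifP => [ajy fy|]; last by rewrite eqxx.
by split => //; exact: subset_closure.
Qed.

Definition cutoff (f : schwartz R X) : schwartz R Y :=
  Schwartz (schwartz_cutoff f).

Lemma cutoff_linear : linear cutoff.
Proof.
move=> c f g; apply/val_inj/funext => y.
rewrite /= -[RHS]/(c * cutoff_fun f y + cutoff_fun g y) /cutoff_fun.
by case: ifP => // _; rewrite mulr0 addr0.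
Qed.

HB.instance Definition _ := GRing.isSemilinear.Build R[i] (schwartz R X)
  (schwartz R Y) _ cutoff (GRing.semilinear_linear cutoff_linear).

Definition cutoff_distribution (T : distribution R Y) : distribution R X :=
  T \o cutoff.

(** Extension by zero off the image of [j]; the chosen preimage is the only one once [j] is
    injective. *)
Definition extend_fun (f : Y -> R[i]) (x : X) : R[i] :=
  if pselect (range j x) is left xj then f (sval (cid2 xj)) else 0.

Lemma extend_funE f y : extend_fun f (j y) = f y.
Proof.
rewrite /extend_fun; case: pselect => [yj|]; last by case; exists y.
by case: cid2 => y' _ /= yy'; congr (f _); exact: j_inj.
Qed.

Section Extend.
Variable f : schwartz R Y.
Hypothesis f_a : forall y, f y != 0 -> a (j y).

Lemma extend_fun_eq0 x : ~~ a x -> extend_fun f x = 0.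
Proof.
move=> ax; rewrite /extend_fun; case: pselect => // xj.
case: cid2 => y _ /= yx; apply/eqP; apply: contraNT ax => /f_a.
by rewrite yx.
Qed.

Lemma schwartz_extend : extend_fun f \in @schwartz_pred R X.
Proof.
have /asboolP[f_lc f_c] := schwartzP f.
apply/asboolP; split=> [x|].
  have [ax|ax] := boolP (a x); last first.
    by apply: filterS (a_lc x) => x' ax'; rewrite !extend_fun_eq0 ?ax'.
  have [y _ yx] := a_range ax; subst x.
  apply: filterS2 (a_lc (j y)) (j_emb (f_lc y)) => x' ax' fx'.
  have [y' _ yx'] : range j x' by apply: a_range; rewrite ax'.
  by rewrite -yx' !extend_funE; exact: fx'.
have jf_c : compact (j @` closure [set y | f y != 0]).
  by apply: continuous_compact => //; exact: continuous_subspaceT.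
apply: (subclosed_compact _ jf_c); first exact: closed_closure.
move=> x clx.
have ax : a x.
  apply: closed_locally_constant => U /clx [x' [/= fx' Ux']].
  exists x'; split => //=; apply: contraNT fx' => /extend_fun_eq0 ->.
  by rewrite eqxx.
have [y _ yx] := a_range ax; subst x; exists y => // U /j_emb yU.
have [x' [/= fx' [ax' jU]]] := clx _ (filterI (a_lc (j y)) yU).
have [y' _ yx'] : range j x' by apply: a_range; rewrite ax'.
exists y'; split; last exact: jU.
by rewrite /= -extend_funE yx'.
Qed.

Definition extend : schwartz R X := Schwartz schwartz_extend.

Lemma extendK : cutoff extend = f.
Proof.
apply/val_inj/funext => y /=; rewrite /cutoff_fun /=.
case: ifPn => [_|ay]; first exact: extend_funE.
by rewrite -extend_funE extend_fun_eq0.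
Qed.

End Extend.
End Embedding.

(** * Ultrametric absolute value and continuity *)

Section AbsoluteValue.
Variables (R : realType) (F : nonarchLocalFieldType R).

Local Notation abs := (@absv R F).

Lemma absv0 : abs 0 = 0.
Proof. by apply/eqP; rewrite absv_eq0. Qed.

Lemma absv1 : abs 1 = 1.
Proof.
have n0 : abs 1 != 0 by rewrite absv_eq0 oner_eq0.
by apply: (mulfI n0); rewrite -absvM !mulr1.
Qed.

Lemma absvN (x : F) : abs (- x) = abs x.
Proof.
suff n1 : abs (-1) = 1 by rewrite -mulN1r absvM n1 mul1r.
apply/eqP; rewrite -(@eqrXn2 _ 2)// ?absv_ge0//.
by rewrite expr2 -absvM mulrNN mulr1 absv1 expr1n.
Qed.

Lemma absvB (x y : F) : abs (x - y) = abs (y - x).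
Proof. by rewrite -absvN opprB. Qed.

Lemma absv_ltD (r : R) (x y : F) : abs x < r -> abs y < r -> abs (x + y) < r.
Proof. by move=> xr yr; rewrite (le_lt_trans (absv_ultra _ _))// gt_max xr. Qed.

(** Isosceles principle: [abs y < abs x] would make both terms of [x = (x - y) + y] smaller than
    [x]. *)
Lemma absv_eq_near (x y : F) : abs (x - y) < abs x -> abs y = abs x.
Proof.
move=> xy; apply/eqP; rewrite eq_le; apply/andP; split.
  rewrite -{1}(subrK x y) (le_trans (absv_ultra _ _))// ge_max lexx andbT.
  by rewrite absvB ltW.
rewrite leNgt; apply/negP => yx.
by have := absv_ltD xy yx; rewrite subrK ltxx.
Qed.

Lemma continuous_absvP (X : topologicalType) (f : X -> F) :
  continuous f <->
  forall x (e : R), 0 < e -> \forall y \near x, abs (f x - f y) < e.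
Proof.
split=> [fc x e e0|fc x U].
  have : nbhs (f x) [set z | abs (f x - z) < e] by rewrite absv_nbhs; exists e.
  exact: fc.
rewrite absv_nbhs => -[e /= e0 eU]; rewrite nbhs_simpl /=.
by apply: filterS (fc x e e0) => y; exact: eU.
Qed.

Variable X : topologicalType.
Implicit Types f g : X -> F.

Lemma continuous_addf f g :
  continuous f -> continuous g -> continuous (fun x => f x + g x).
Proof.
move=> /continuous_absvP fc /continuous_absvP gc.
apply/continuous_absvP => x e e0.
near=> y; rewrite opprD addrACA; apply: absv_ltD.
  by near: y; exact: fc.
by near: y; exact: gc.
Unshelve. all: by end_near. Qed.

Lemma continuous_mulf f g :
  continuous f -> continuous g -> continuous (fun x => f x * g x).
Proof.
move=> /continuous_absvP fc /continuous_absvP gc.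
apply/continuous_absvP => x e e0.
(* Adding 1 keeps the divisors positive and, for [g], gives a bound on [abs (g y)] for all [y] with
   [abs (g x - g y) < 1]. *)
have f0 : 0 < abs (f x) + 1 by rewrite ltr_wpDl ?absv_ge0.
have g0 : 0 < abs (g x) + 1 by rewrite ltr_wpDl ?absv_ge0.
near=> y.
have -> : f x * g x - f y * g y = f x * (g x - g y) + (f x - f y) * g y.
  by rewrite mulrBr mulrBl addrA subrK.
apply: absv_ltD; rewrite absvM.
  have : abs (g x - g y) < e / (abs (f x) + 1).
    by near: y; apply: gc; rewrite divr_gt0.
  rewrite ltr_pdivlMr// mulrC; apply: le_lt_trans.
  by rewrite ler_wpM2r ?absv_ge0// lerDl.
have : abs (f x - f y) < e / (abs (g x) + 1).
  by near: y; apply: fc; rewrite divr_gt0.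
rewrite ltr_pdivlMr//; apply: le_lt_trans.
rewrite ler_wpM2l ?absv_ge0//.
rewrite -{1}(subKr (g x) (g y)) (le_trans (absv_ultra _ _))// absvN.
rewrite ge_max lerDl ler01/= (@le_trans _ _ 1)// ?lerDr ?absv_ge0//.
by apply: ltW; near: y; exact: gc.
Unshelve. all: by end_near. Qed.

Lemma continuous_sum (I : Type) (r : seq I) (P : pred I) (f : I -> X -> F) :
  (forall i, continuous (f i)) ->
  continuous (fun x => \sum_(i <- r | P i) f i x).
Proof.
move=> fc; elim: r => [|i r IHr].
  by under eq_fun do rewrite big_nil; exact: cst_continuous.
under eq_fun do rewrite big_cons; case: (P i) => //.
exact: continuous_addf.
Qed.

Lemma continuous_prod (I : Type) (r : seq I) (P : pred I) (f : I -> X -> F) :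
  (forall i, continuous (f i)) ->
  continuous (fun x => \prod_(i <- r | P i) f i x).
Proof.
move=> fc; elim: r => [|i r IHr].
  by under eq_fun do rewrite big_nil; exact: cst_continuous.
under eq_fun do rewrite big_cons; case: (P i) => //.
exact: continuous_mulf.
Qed.

Lemma continuous_det n (A : X -> 'M[F]_n) :
  (forall i j, continuous (fun x => A x i j)) ->
  continuous (fun x => \det (A x)).
Proof.
(* The determinant unfolds to its Leibniz expansion, a sum of signed products of entries. *)
move=> Ac; apply: continuous_sum => s.
apply: continuous_mulf; first exact: cst_continuous.
exact: continuous_prod.
Qed.

(** Near a zero of [f] the inequality fails throughout because [e] is positive; near any other point
    [abs (f x)] itself is locally constant. *)
Lemma locally_constant_absv_ge f (e : R) :
  0 < e -> continuous f -> locally_constant (fun x => e <= abs (f x)).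
Proof.
move=> e0 /continuous_absvP fc x.
have [fx0|fx0] := eqVneq (f x) 0.
  near=> y; suff fye : abs (f y) < e.
    by rewrite fx0 absv0 !leNgt fye e0.
  by rewrite -absvN -sub0r -fx0; near: y; exact: fc.
near=> y; rewrite (@absv_eq_near (f x) (f y))//.
by near: y; apply: fc; rewrite lt_def absv_eq0 fx0 absv_ge0.
Unshelve. all: by end_near. Qed.

Lemma compact_absv_lower_bound f (K : set X) :
  continuous f -> compact K -> (forall x, K x -> f x != 0) ->
  exists2 e : R, 0 < e & forall x, K x -> e <= abs (f x).
Proof.
move=> /continuous_absvP fc /compact_near_coveringP Kc K0.
(* Each point of [K] has a neighbourhood on which [abs (f x)] is constant, so every small [e] works
   there; near-covering compactness makes the choice uniform on [K]. *)
pose P (e : R) (x : X) := e <= abs (f x).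
have : \forall e \near 0^'+, K `<=` P e.
  apply: Kc => x /K0 fx0.
  have fxp : 0 < abs (f x) by rewrite lt_def absv_eq0 fx0 absv_ge0.
  exists ([set y | abs (f x - f y) < abs (f x)], [set e | e <= abs (f x)]).
    by split; [exact: fc|exact: nbhs_right_le].
  by move=> [y e] /= [/absv_eq_near fyx ex]; rewrite /P fyx.
move=> KP.
near (0 : R)^'+ => e.
exists e; first by near: e; exact: nbhs_right_gt.
by near: e.
Unshelve. all: by end_near. Qed.

End AbsoluteValue.

(** * Continuity of linear forms in finite dimension *)

Section FinDimTopology.
Variables (R : realType) (F : nonarchLocalFieldType R).

Lemma mx_entry_continuous m n i j : continuous (fun A : 'M[F]_(m, n) => A i j).
Proof.
move=> A U AU.
(* Product neighbourhood that constrains only the entry [(i, j)]. *)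
exists (fun i' j' => [set z | i' = i -> j' = j -> U z]).
  move=> i' j'; have [->|/eqP ii'] := eqVneq i' i;
    last by apply: nearW => z /ii'.
  have [->|/eqP jj'] := eqVneq j' j;
    last by apply: nearW => z _ /jj'.
  by apply: filterS AU => z Uz.
by move=> B /= /(_ i j); exact.
Qed.

Lemma linear_continuous (V : vectType F) (f : {linear V -> F^o}) :
  continuous (f : fdtop V -> F).
Proof.
have -> : (f : fdtop V -> F) =
    fun v => \sum_i coord (vbasis {:V}) i v * f (vbasis {:V})`_i.
  apply/funext => v.
  rewrite {1}(coord_vbasis (memvf (v : V))) linear_sum.
  by apply: eq_bigr => i _; rewrite linearZ.
apply: continuous_sum => i; apply: continuous_mulf; last exact: cst_continuous.
pose c (v : fdtop V) := \row_i coord (vbasis {:V}) i v.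
have cE : (coord (vbasis {:V}) i : fdtop V -> F) =
    (fun A : 'rV_(\dim {:V}) => A ord0 i) \o c.
  by apply/funext => v; rewrite /= mxE.
rewrite -[X in continuous X]/(coord (vbasis {:V}) i : fdtop V -> F) cE.
move=> v; apply: continuous_comp; last exact: mx_entry_continuous.
exact: initial_continuous.
Qed.

End FinDimTopology.

(** * The determinant under conjugation and sigma *)

Section Determinant.
Variables (R : realType) (F : nonarchLocalFieldType R) (V : vectType F).
Variable e : (\dim {:V}).-tuple V.

(** Row convention: row [i] holds the coordinates of [x e_i], so matrices act on the right of
    coordinate rows and composition reverses the product. *)
Definition end_mx (x : 'End(V)) : 'M[F]_(\dim {:V}) :=
  \matrix_(i, j) coord e j (x e`_i).

Definition end_det (x : 'End(V)) : F := \det (end_mx x).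

Hypothesis e_basis : basis_of {:V} e.

Lemma end_mxM (x y : 'End(V)) : end_mx (x \o y)%VF = end_mx y *m end_mx x.
Proof.
apply/matrixP => i k; rewrite !mxE comp_lfunE.
rewrite {1}(coord_basis e_basis (memvf (y e`_i))) !linear_sum /=.
by apply: eq_bigr => l _; rewrite !mxE !linearZ.
Qed.

Lemma end_mx1 : end_mx \1%VF = 1%:M.
Proof.
by apply/matrixP => i k; rewrite !mxE id_lfunE coord_free ?(basis_free e_basis).
Qed.

Lemma end_det_conj (g : GL V) (x : 'End(V)) :
  end_det (conj_end (\val g) x) = end_det x.
Proof.
have gV : (\val g \o (\val g)^-1)%VF = \1%VF.
  by case: g => g /set_mem /= gI; exact: lker0_compfV.
rewrite /end_det /conj_end !end_mxM !det_mulmx mulrCA -det_mulmx -end_mxM gV.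
by rewrite end_mx1 det1 mulr1.
Qed.

Lemma GLP (x : 'End(V)) : GL V x <-> end_det x != 0.
Proof.
split=> [/lker0_compVf xV|x0].
  apply: contra_eqN (congr1 end_det xV) => /eqP x0.
  by rewrite /end_det end_mxM end_mx1 det_mulmx -/(end_det x) x0 mul0r det1
    eq_sym oner_eq0.
rewrite /GL /= -subv0; apply/subvP => v; rewrite memv_ker memv0 => /eqP xv.
have xU : end_mx x \in unitmx by rewrite unitmxE unitfE.
(* The coordinate row of a kernel vector is killed by an invertible matrix. *)
pose c := \row_i coord e i v.
have cx : c *m end_mx x = 0.
  apply/rowP => k; rewrite !mxE.
  transitivity (coord e k (x v)); last by rewrite xv linear0.
  rewrite {1}(coord_basis e_basis (memvf v)) !linear_sum.
  by apply: eq_bigr => l _; rewrite !mxE !linearZ.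
have c0 : c = 0 by rewrite -(mulmxK xU c) cx mul0mx.
apply/eqP; rewrite (coord_basis e_basis (memvf v)) big1// => i _.
by move/rowP: c0 => /(_ i); rewrite !mxE => ->; rewrite scale0r.
Qed.

(** Seen as a bilinear form, [u_map e] is the symmetric form with Gram matrix the identity when [e]
    is a basis. *)
Lemma u_map_dual (v w : V) : u_map e v w = \sum_i coord e i v * coord e i w.
Proof.
rewrite lfunE /= /u_fun sum_lfunE; apply: eq_bigr => i _.
by rewrite !lfunE /= lfunE.
Qed.

Lemma coord_u_map (v : V) i : coord e i v = u_map e v e`_i.
Proof.
rewrite u_map_dual (bigD1 i)//= coord_free ?(basis_free e_basis)//.
rewrite eqxx mulr1 big1 ?addr0// => k ki.
by rewrite coord_free ?(basis_free e_basis)// eq_sym (negbTE ki) mulr0.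
Qed.

(** The [k]-th coordinate of the image of [e_i] is read off by applying [u] and evaluating at [e_k];
    this gives [e_i^*(x e_k)], the entry [(k, i)] of the matrix of [x]. *)
Lemma end_mx_sigma (x : 'End(V)) : end_mx (sigma_end e x) = (end_mx x)^T.
Proof.
apply/matrixP => i k; rewrite !mxE coord_u_map !comp_lfunE.
rewrite (u_mapVK e_basis) [tr _ _]lfunE /= /tr_fun comp_lfunE.
by rewrite (u_map_basis e_basis) lfunE.
Qed.

Lemma end_det_sigma (x : 'End(V)) : end_det (sigma_end e x) = end_det x.
Proof. by rewrite /end_det end_mx_sigma det_tr. Qed.

End Determinant.

(** * The group space inside the Lie algebra space *)

Section GroupInLie.
Variables (R : realType) (F : nonarchLocalFieldType R) (V : vectType F).

Definition incl (p : groupSpace V) : lieSpace V :=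
  let: (x, v, w) := p in (\val x, v, w).

Lemma incl_inj : injective incl.
Proof.
by move=> [[x v] w] [[x' v'] w'] [/= /val_inj -> -> ->].
Qed.

Lemma incl_continuous : continuous incl.
Proof.
move=> [[x v] w] U [[A B] [/= [[A1 A2] [/= A1x A2v] A12] Bw] AB].
exists ((\val @^-1` A1) `*` A2, B) => /=.
  split => //; exists (\val @^-1` A1, A2) => //; split => //=.
  exact: initial_continuous.
move=> [[x' v'] w'] /= [[A1x' A2v'] Bw'].
by apply: AB; split => //=; exact: A12.
Qed.

Lemma incl_embedding (q : groupSpace V) (U : set (groupSpace V)) : nbhs q U ->
  \forall p \near incl q, forall q', incl q' = p -> U q'.
Proof.
case: q => [[x v] w] [[A B] [/= [[A1 A2] [/= A1x A2v] A12] Bw] AB].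
(* [GL] carries the subspace topology, so the neighbourhood [A1] contains the trace of an open set
   [O] of endomorphisms. *)
have [_ [[O oO <-] Ox OA1]] := A1x.
exists (O `*` A2, B) => /=.
  split => //; exists (O, A2) => //; split => //=.
  exact: open_nbhs_nbhs.
move=> [[y v'] w'] /= [[Oy A2v'] Bw'] [[y' v''] w''] [yy' -> ->].
apply: AB; split => //=; apply: A12; split => //=; apply: OA1.
by rewrite /= /set_val /= yy'.
Qed.

Variable e : (\dim {:V}).-tuple V.

Definition lie_det (p : lieSpace V) : F := end_det e p.1.1.

Lemma lie_det_continuous : continuous lie_det.
Proof.
apply: continuous_det => i k.
have entry_linear : linear (fun x : 'End(V) => coord e k (x e`_i) : F^o).
  by move=> a x y; rewrite !lfunE /= lfunE linearP.
pose entryA := GRing.isSemilinear.Build F 'End(V) F^o _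
  (fun x : 'End(V) => coord e k (x e`_i) : F^o)
  (GRing.semilinear_linear entry_linear).
pose entry : {linear 'End(V) -> F^o} := HB.pack
  (fun x : 'End(V) => coord e k (x e`_i) : F^o) entryA.
have -> : (fun p : lieSpace V => end_mx e p.1.1 i k) =
    (entry : fdtop 'End(V) -> F) \o (fun p : lieSpace V => p.1.1).
  by apply/funext => p; rewrite !mxE.
move=> p; apply: continuous_comp; last exact: linear_continuous.
by apply: continuous_comp; exact: cvg_fst.
Qed.

Lemma incl_act (g : GL V) q : incl (act_group g q) = act_lie g (incl q).
Proof. by case: q => [[x v] w]. Qed.

Hypothesis e_basis : basis_of {:V} e.

Lemma incl_sigma q : incl (sigma_group e_basis q) = sigma_lie e (incl q).
Proof. by case: q => [[x v] w]. Qed.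

Lemma lie_det_act (g : GL V) p : lie_det (act_lie g p) = lie_det p.
Proof. by case: p => [[x v] w]; exact: end_det_conj. Qed.

Lemma lie_det_sigma p : lie_det (sigma_lie e p) = lie_det p.
Proof. by case: p => [[x v] w]; exact: end_det_sigma. Qed.

Lemma lie_det_incl q : lie_det (incl q) != 0.
Proof. by case: q => [[[x xG] v] w]; apply/(GLP e_basis); exact: set_mem. Qed.

Lemma range_incl p : lie_det p != 0 -> range incl p.
Proof.
case: p => [[x v] w] /(GLP e_basis) /mem_set xG.
by exists (SigSub xG : GL V, v, w).
Qed.

End GroupInLie.

(** * Descent from the group to the Lie algebra *)

Theorem mainTheorem6 (R : realType) :
  (forall F : nonarchLocalFieldType R, [pchar F] =i pred0 ->
   forall (V : vectType F) (e : (\dim {:V}).-tuple V), basis_of {:V} e ->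
   forall T : distribution R (lieSpace V),
   (forall g : GL V, invariant_under (act_lie g) T) ->
   invariant_under (sigma_lie e) T) ->
  (forall F : nonarchLocalFieldType R, [pchar F] =i pred0 ->
   forall (V : vectType F) (e : (\dim {:V}).-tuple V)
     (e_basis : basis_of {:V} e),
   forall T : distribution R (groupSpace V),
   (forall g : GL V, invariant_under (act_group g) T) ->
   invariant_under (sigma_group e_basis) T).
Proof.
move=> lie_case F F0 V e e_basis T T_inv f h hf.
have /asboolP[_ f_c] := schwartzP f.
have det_incl : continuous (lie_det e \o @incl R F V).
  by move=> q; apply: continuous_comp;
    [exact: incl_continuous|exact: lie_det_continuous].
(* The determinant has no zero on the group space, so it is bounded below on the compact support of
   [f]. *)
have [eps eps0 f_eps] := compact_absv_lower_bound det_incl f_c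
  (fun q _ => lie_det_incl e_basis q).
pose a p := eps <= absv (lie_det e p).
have a_lc : locally_constant a.
  exact: locally_constant_absv_ge eps0 (@lie_det_continuous R F V e).
have a_range p : a p -> range (@incl R F V) p.
  move=> ap; apply: (range_incl e_basis); rewrite -absv_eq0.
  by rewrite gt_eqF// (lt_le_trans eps0).
have a_sigma p : a (sigma_lie e p) = a p by rewrite /a lie_det_sigma.
have f_a q : f q != 0 -> a (incl q).
  by move=> fq; apply: f_eps; exact: subset_closure.
(* Sigma preserves the determinant, so the same [eps] serves for [h]. *)
have h_a q : h q != 0 -> a (incl q).
  by rewrite hf /= => /f_a; rewrite incl_sigma a_sigma.
pose T' := cutoff_distribution (@incl_continuous R F V)
  (@incl_embedding R F V) a_lc a_range T.
have T'_inv g : invariant_under (act_lie g) T'.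
  move=> f' h' hf'; apply: (T_inv g); apply/funext => q /=.
  by rewrite /cutoff_fun incl_act /a lie_det_act// hf'.
(* The hypothesis is applied to the extensions by zero of [f] and [h], whose cutoffs are [f] and [h]
   again. It remains that these extensions correspond under sigma: on [a] by equivariance of [incl],
   off [a] because both vanish. *)
have := lie_case F F0 V e e_basis T' T'_inv
  (extend (@incl_inj R F V) (@incl_continuous R F V)
    (@incl_embedding R F V) a_lc a_range f_a)
  (extend (@incl_inj R F V) (@incl_continuous R F V)
    (@incl_embedding R F V) a_lc a_range h_a).
rewrite /T' /cutoff_distribution /= !extendK; apply.
apply/funext => p /=; have [ap|ap] := boolP (a p).
  have [q _ <-] := a_range _ ap.
  by rewrite -(incl_sigma e_basis) !(extend_funE (@incl_inj R F V)) hf.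
by rewrite (extend_fun_eq0 h_a)// (extend_fun_eq0 f_a)// a_sigma.
Qed.
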